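(* There is an absolute constant $c>0$ such that for every real $0<\alpha<1$ there exists an infinite sequence $\mathcal{A}$ of positive integers with $d^{*}(\mathcal{A})>\alpha$ such that, writing $\mathcal{B}=\mathcal{A}\cdot\mathcal{A}=\{b_1<b_2<\cdots\}$, we have $b_{n+1}-b_n\ge c\,\alpha^{-3}$ for every $n$.
   Context: For an infinite set $\mathcal{A}$ of positive integers, the upper Banach density is $d^{*}(\mathcal{A})=\limsup_{|I|\to\infty}\frac{|\mathcal{A}\cap I|}{|I|}$, where $I$ runs through all intervals of integers. The product set $\mathcal{A}\cdot\mathcal{A}$ is the set of all products $a_ia_j$ with $a_i,a_j\in\mathcal{A}$, and $b_1<b_2<\cdots$ denotes its elements in increasing order. *)

(* Defs.v *)
From mathcomp Require Import all_boot all_order all_algebra.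
From mathcomp Require Import all_classical all_reals all_analysis.
Set Implicit Arguments.
Unset Strict Implicit.
Unset Printing Implicit Defensive.
Import Order.TTheory GRing.Theory Num.Theory.
Local Open Scope classical_set_scope.
Local Open Scope ring_scope.

(* A pair I = (a, n) stands for the interval {a, a + 1, ..., a + n - 1} of
   integers, with |I| = n. *)
Definition int_itv (I : int * nat) : seq int :=
  [seq I.1 + k%:Z | k <- iota 0 I.2].

(* The filter of the limit |I| -> oo, uniform in the position of I. *)
Definition itv_length_oo : set_system (int * nat) :=
  filter_from setT
    (fun N : nat => [set I : int * nat | (N <= size (int_itv I))%N]).

(* |A `&` I| / |I|; the value 0 at empty intervals is irrelevant in the limit. *)
Definition itv_density (R : realType) (A : set int) (I : int * nat) : R :=
  (count (fun x => x \in A) (int_itv I))%:R / (size (int_itv I))%:R.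

(* limf_esup wants a filteredType as domain, whose structure it does not use;
   the alias discrete_topology supplies one for int * nat. *)
Definition upper_banach_density (R : realType) (A : set int) : \bar R :=
  limf_esup (fun I : discrete_topology (int * nat) => (itv_density R A I)%:E)
            itv_length_oo.

Lemma upper_banach_densityE (R : realType) (A : set int) :
  upper_banach_density R A =
  ereal_inf [set ereal_sup [set (itv_density R A I)%:E | I in V]
            | V in itv_length_oo].
Proof. by []. Qed.

Definition product_set (A : set int) : set int :=
  [set x * y | x in A & y in A].

(* Indexing is from 0: b 0 is the least element of B. *)
Definition increasing_enum (B : set int) (b : nat -> int) : Prop :=
  {homo b : m n / (m < n)%N >-> m < n} /\ range b = B.

(* Main.v *)
Require Import Defs.
From mathcomp Require Import all_boot all_order all_algebra cyclic finfield.
From mathcomp Require Import all_classical all_reals all_analysis.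
From mathcomp Require Import zify ring lra.
Import Order.TTheory GRing.Theory Num.Theory.
Local Open Scope ring_scope.

(* Let q = 2 ^ m be of order 1 / alpha and n = q ^ 2 - 1. Bose's Sidon set modulo
   n has q elements; deleting at most q / 2 of them makes all its gaps modulo n
   at least h = q / 2. Let S be the set of integers whose residue modulo n is
   kept: it has density of order alpha. If s, t, s', t' are in S with
   s + t = s' + t', then s't' - st = (s' - s)(t' - s); if this is positive, the
   Sidon property makes one factor a multiple of n, and the other one is at
   least h, so s't' - st >= hn, which is of order alpha ^ -3.
   A is the union of the translates x_k + (S `&` [0, (k + 1)n)) for a very fast
   growing sequence x_k. The leading terms in x_k separate two products unless
   both are products of elements of the same piece, with s + t = s' + t', or
   they share their factor outside the last piece; such a factor exceeds hn. *)

(** * Sidon sets modulo n: Bose's construction and removal of small gaps *)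

Definition sidon_mod {n : nat} (T : {set 'I_n}) : Prop :=
  forall a b c d : 'I_n, a \in T -> b \in T -> c \in T -> d \in T ->
    (a + b = c + d %[mod n])%N -> a = c \/ a = d.

Lemma finField_prim_root (F : finFieldType) :
  exists z : F, #|F|.-1.-primitive_root z.
Proof.
have F_gt1 := finNzRing_gt1 F.
have n_gt0 : (0 < #|F|.-1)%N by rewrite -subn1 subn_gt0.
have [||z _ zP] := hasP (@has_prim_root _ #|F|.-1 (enum [set~ (0 : F)]) n_gt0 _
                           (enum_uniq _) _).
- apply/allP => x; rewrite mem_enum !inE unity_rootE => x0.
  apply/eqP; apply: (mulfI x0); rewrite mulr1 -exprS prednK ?expf_card //; lia.
- by rewrite -cardE cardsC1.
by exists z.
Qed.

(** For a generator [z] of the multiplicative group, [z ^+ q.+1] has order q - 1; its powers,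
    together with 0, are fixed points. *)
Lemma Frobenius_fixed_card (F : finFieldType) (q : nat) :
  (1 < q)%N -> #|F| = (q ^ 2)%N -> (q <= #|[set x : F | x ^+ q == x]|)%N.
Proof.
move=> q_gt1 cardF; have [z z_prim] := finField_prim_root F.
have cardE : #|F|.-1 = ((q - 1) * q.+1)%N by rewrite cardF; lia.
rewrite cardE in z_prim.
pose s := (0 : F) :: [seq z ^+ (i * q.+1) | i <- iota 0 (q - 1)].
have /card_uniqP sz_s : uniq s.
  rewrite /= map_inj_in_uniq ?iota_uniq ?andbT.
    apply/mapP => -[i _] /esym/eqP; rewrite expf_eq0 => /andP[_ /eqP z0].
    have /eqP := prim_expr_order z_prim.
    by rewrite z0 expr0n -leqn0 leqNgt (prim_order_gt0 z_prim) eq_sym oner_eq0.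
  move=> i j; rewrite !mem_iota => hi hj /eqP.
  rewrite (eq_prim_root_expr z_prim) -!muln_modl !modn_small ?eqn_pmul2r //; lia.
apply: (@leq_trans #|s|); first by rewrite sz_s /= size_map size_iota; lia.
apply: subset_leq_card; apply/fintype.subsetP => x; rewrite !inE => /orP[/eqP->|].
  by rewrite expr0n; case: (q) q_gt1.
case/mapP => i _ ->; rewrite -exprM; apply/eqP.
have -> : (i * q.+1 * q = (q - 1) * q.+1 * i + i * q.+1)%N by nia.
by rewrite exprD exprM (prim_expr_order z_prim) expr1n mul1r.
Qed.

(* Bose's construction: the discrete logarithms of a translate [z + K] of the
   subfield [K] of order [q] in a field of order [q ^ 2]. *)
Lemma sidon_mod_Bose (m : nat) : (0 < m)%N ->
  exists2 T : {set 'I_((2 ^ m) ^ 2 - 1)}, (2 ^ m <= #|T|)%N & sidon_mod T.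
Proof.
move=> m_gt0; set q := (2 ^ m)%N; set n := (q ^ 2 - 1)%N.
have q_gt1 : (1 < q)%N by rewrite (ltn_exp2l 0).
have [F charF cardF] : {F : finFieldType | 2%N \in [pchar F] & #|F| = (q ^ 2)%N}.
  by rewrite /q -expnM; apply: pPrimePowerField; rewrite ?muln_gt0 ?m_gt0.
have q_char : [pchar F].-nat q.
  apply/pnatP => // [|p p_pr]; rewrite /q ?Euclid_dvdX //; first by lia.
  by rewrite dvdn_prime2 // => /andP[/eqP->].
have [z z_prim] := finField_prim_root F.
have nE : #|F|.-1 = n by rewrite cardF /n; lia.
rewrite nE in z_prim.
pose K := [set x : F | x ^+ q == x].
have KP x : reflect (x ^+ q = x) (x \in K) by rewrite inE; apply: eqP.
have KD x y : x \in K -> y \in K -> x + y \in K.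
  by move=> /KP xK /KP yK; apply/KP; rewrite exprDn_pchar // xK yK.
have KM x y : x \in K -> y \in K -> x * y \in K.
  by move=> /KP xK /KP yK; apply/KP; rewrite exprMn xK yK.
have KV x : x \in K -> x^-1 \in K by move=> /KP xK; apply/KP; rewrite exprVn xK.
have KN x : x \in K -> - x \in K.
  move=> xK; suff -> : - x = x by [].
  by apply/oppr_pchar2.
have zNK : z \notin K.
  rewrite inE -{2}[z]expr1 (eq_prim_root_expr z_prim) !modn_small; rewrite /n; nia.
pose T := [set i : 'I_n | z ^+ i - z \in K].
exists T.
  (* Each [z + x] with [x] in [K] is nonzero because [z] is not in [K], hence it is a power of [z]:
     so [K] lies in the image of [T] under [z ^+ i - z]. *)
  apply: leq_trans (Frobenius_fixed_card F q q_gt1 cardF) _.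
  apply: leq_trans (leq_imset_card (fun i : 'I_n => z ^+ i - z) (mem T)).
  apply/subset_leq_card/fintype.subsetP => x xK; apply/imsetP.
  have zx0 : z + x != 0.
    by apply: contraNneq zNK => /eqP; rewrite addr_eq0 => /eqP ->; apply: KN.
  have [|i zxE] := @prim_rootP _ _ _ z_prim (z + x).
    apply: (mulfI zx0); rewrite mulr1 -exprS -nE prednK ?expf_card //.
    by rewrite cardF; lia.
  have xE : x = z ^+ i - z by rewrite -zxE; ring.
  by exists i => //; rewrite inE -xE.
have subP i : i \in T -> exists2 x, x \in K & z ^+ i = z + x.
  by rewrite inE => xK; exists (z ^+ i - z) => //; ring.
move=> a b c d /subP[x xK aE] /subP[y yK bE] /subP[u uK cE] /subP[v vK dE] /eqP.
rewrite -(eq_prim_root_expr z_prim) !exprD aE bE cE dE => /eqP E.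
(* The squares of [z] cancel in (z + x)(z + y) = (z + u)(z + v). This leaves a linear relation over
   [K]; as [z] is not in [K], both coefficients vanish. *)
have {}E : z * (x + y - (u + v)) = u * v - x * y.
  have -> : z * (x + y - (u + v)) =
      (z + x) * (z + y) - (z + u) * (z + v) + (u * v - x * y) by ring.
  by rewrite E subrr add0r.
have sumE : x + y - (u + v) = 0.
  apply: contraNeq zNK => s0.
  have -> : z = (u * v - x * y) / (x + y - (u + v)) by rewrite -E mulfK.
  by rewrite KM ?KV ?KD ?KN ?KM ?KD.
(* Now [x, y] and [u, v] have the same sum and the same product, so [x] is a root of (X - u)(X -
   v). *)
have : (x - u) * (x - v) = 0.
  move: E; rewrite sumE mulr0 => E.
  have -> : (x - u) * (x - v) = (u * v - x * y) + x * (x + y - (u + v)) by ring.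
  by rewrite -E sumE; ring.
have expI (i j : 'I_n) : z ^+ i = z ^+ j -> i = j.
  by move/eqP; rewrite (eq_prim_root_expr z_prim) !modn_small // => /eqP/val_inj.
move/eqP; rewrite mulf_eq0 !subr_eq0 => /orP[] /eqP xE; [left|right]; apply: expI.
  by rewrite aE cE xE.
by rewrite aE dE xE.
Qed.

(* In a Sidon set each nonzero residue occurs at most once as a difference, so
   fewer than [h] elements start a difference smaller than [h]. *)
Lemma sidon_mod_thin (n h : nat) (T : {set 'I_n}) : sidon_mod T ->
  exists T' : {set 'I_n}, [/\ T' \subset T, (#|T| <= #|T'| + h)%N &
    forall a b : 'I_n, a \in T' -> b \in T' -> a != b ->
      (h <= (b + n - a) %% n)%N].
Proof.
(* Adding [n] first keeps the truncated subtraction exact. *)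
move=> sT; pose close (a b : 'I_n) := [&& b \in T, b != a & ((b + n - a) %% n < h)%N].
pose bad := [set a in T | [exists b, close a b]].
exists (T :\: bad); split; first exact: subsetDl.
  have badT : bad \subset T by apply/fintype.subsetP => a; rewrite inE => /andP[].
  rewrite cardsDS // -leq_subLR subKn ?subset_leq_card //.
  (* The default [a] is never reached on [bad]. The differences [d a] will be distinct and below h,
     which bounds the size of [bad] by h. *)
  pose w a := odflt a [pick b | close a b].
  have wP a : a \in bad -> close a (w a).
    rewrite inE => /andP[_ /existsP[b ab]]; rewrite /w.
    by case: pickP => [//|/(_ b)]; rewrite ab.
  pose d a := ((w a + n - a) %% n)%N.
  rewrite cardE -(size_map d) -[leqRHS](size_iota 0); apply: uniq_leq_size.
    rewrite map_inj_in_uniq ?enum_uniq // => a a'; rewrite !mem_enum => aB a'B.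
    have aT := fintype.subsetP badT _ aB; have a'T := fintype.subsetP badT _ a'B.
    have /and3P[wT waN _] := wP _ aB; have /and3P[w'T _ _] := wP _ a'B.
    rewrite /d => /eqP E.
    have ale : (a <= w a + n)%N by rewrite (leq_trans (ltnW (ltn_ord a))) ?leq_addl.
    have a'le : (a' <= w a' + n)%N by rewrite (leq_trans (ltnW (ltn_ord a'))) ?leq_addl.
    (* Equal differences give w a + a' = w a' + a modulo n. By the Sidon property either
       [w a = w a'], which forces a = a', or [w a = a], which [close] excludes. *)
    have [] := sT (w a) a' (w a') a wT a'T w'T aT.
    - move: E; rewrite -(eqn_modDr (a + a')).
      have -> : (w a + n - a + (a + a') = w a + a' + n)%N.
        by rewrite addnA subnK // addnAC.
      have -> : (w a' + n - a' + (a + a') = w a' + a + n)%N.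
        by rewrite addnCA subnK // addnCA addnA.
      by rewrite !modnDr => /eqP.
    - move=> wE; move: E; rewrite wE -(eqn_modDr (a + a')).
      have -> : (w a' + n - a + (a + a') = w a' + n + a')%N by rewrite addnA subnK // -wE.
      have -> : (w a' + n - a' + (a + a') = w a' + n + a)%N.
        by rewrite addnCA subnK // addnC.
      by rewrite eqn_modDl !modn_small // => /eqP/val_inj.
    by move=> wE; rewrite wE eqxx in waN.
  move=> _ /mapP[a + ->]; rewrite mem_enum => /wP /and3P[_ _ lt_h].
  by rewrite mem_iota.
move=> a b; rewrite !inE => /andP[+ aT] /andP[_ bT] aNb.
rewrite aT /= negb_exists => /forallP /(_ b).
by rewrite /close bT eq_sym aNb /= -leqNgt.
Qed.

(** * Periodic lift to the natural numbers *)

Definition lift_mod {n : nat} (T : {set 'I_n}) : pred nat :=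
  fun s => [exists a in T, nat_of_ord a == (s %% n)%N].

Lemma count_lift_mod (n : nat) (T : {set 'I_n}) (k : nat) :
  count (lift_mod T) (iota 0 (k * n)) = (k * #|T|)%N.
Proof.
have count1 : count (lift_mod T) (iota 0 n) = #|T|.
  rewrite -val_enum_ord count_map enumT cardE size_filter.
  apply: eq_count => i /=; apply/exists_inP/idP => [[a aT]|iT].
    by rewrite modn_small // => /eqP/val_inj <-.
  by exists i; rewrite // modn_small.
elim: k => // k IH; rewrite mulSn iotaD count_cat add0n count1 mulSn; congr addn.
rewrite -IH -[n in iota n]addn0 iotaDl count_map; apply: eq_count => s /=.
by rewrite /lift_mod modnDl.
Qed.

(** Distinct numbers with equal residues differ by a positive multiple of n, hence by at least h;
    otherwise t - s is at least its own residue modulo n. *)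
Lemma lift_mod_gap (n h : nat) (T : {set 'I_n}) : (h <= n)%N ->
  (forall a b : 'I_n, a \in T -> b \in T -> a != b -> (h <= (b + n - a) %% n)%N) ->
  forall s t : nat, lift_mod T s -> lift_mod T t -> (s < t)%N -> (h <= t - s)%N.
Proof.
move=> hn gapT s t /exists_inP[a aT /eqP aE] /exists_inP[b bT /eqP bE] st.
have [ab|/gapT -/(_ aT bT) hab] := eqVneq a b.
  apply: leq_trans hn _; apply: dvdn_leq; first by rewrite subn_gt0.
  by rewrite -eqn_mod_dvd ?(ltnW st) // -aE -bE ab.
apply: leq_trans hab _.
have tE := divn_eq t n; have sE := divn_eq s n; rewrite -aE in sE; rewrite -bE in tE.
have an := ltn_ord a.
suff -> : ((b + n - a) %% n = (t - s) %% n)%N by exact: leq_mod.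
rewrite -(modnMDl (t %/ n)) -[RHS](modnMDl (s %/ n).+1); congr modn.
by rewrite mulSn; lia.
Qed.

Lemma lift_mod_parallelogram (n h : nat) (T : {set 'I_n}) : (h <= n)%N ->
  sidon_mod T ->
  (forall a b : 'I_n, a \in T -> b \in T -> a != b -> (h <= (b + n - a) %% n)%N) ->
  forall s t s' t' : nat, lift_mod T s -> lift_mod T t ->
    lift_mod T s' -> lift_mod T t' ->
    (s + t = s' + t' -> s * t < s' * t' -> s * t + h * n <= s' * t')%N.
Proof.
move=> hn sT gapT s t s' t'.
wlog st : s t / (s <= t)%N.
  move=> IH sS tS; have [/IH|/ltnW/IH] := leqP s t; first exact.
  by rewrite (addnC t) (mulnC t); apply.
wlog st' : s' t' / (s' <= t')%N.
  move=> IH sS tS s'S t'S; have [/IH|/ltnW/IH] := leqP s' t'; first exact.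
  by rewrite (addnC t') (mulnC t'); apply.
move=> sS tS s'S t'S eqD ltM.
(* For equal sums the larger product has the more balanced factors, so both s' and t' exceed the
   smaller factor s. *)
have ss' : (s < s')%N by nia.
have st2' : (s < t')%N by lia.
have gap := lift_mod_gap n h T hn gapT.
have hu := gap _ _ sS s'S ss'; have hv := gap _ _ sS t'S st2'.
suff H : (n <= s' - s)%N \/ (n <= t' - s)%N.
  have -> : (s' * t' = s * t + (s' - s) * (t' - s))%N.
    have -> : t = (s' + t' - s)%N by lia.
    nia.
  by rewrite leq_add2l; case: H => H; [rewrite mulnC|]; apply: leq_mul.
move: sS tS s'S t'S => /exists_inP[a aT /eqP aE] /exists_inP[b bT /eqP bE].
move=> /exists_inP[c cT /eqP cE] /exists_inP[d dT /eqP dE].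
have [] := sT a b c d aT bT cT dT.
- by rewrite aE bE cE dE !modnDm eqD.
- move=> ac; left; apply: dvdn_leq; first by lia.
  by rewrite -eqn_mod_dvd ?(ltnW ss') // -aE -cE ac.
- move=> ad; right; apply: dvdn_leq; first by lia.
  by rewrite -eqn_mod_dvd ?(ltnW st2') // -aE -dE ad.
Qed.

(** * Products of elements of fast growing translates *)

(** The first bound lets [x k] absorb a product of two offsets in piece k; the second lets it absorb
    products of earlier elements with each other or with an offset below [N k], always with g to
    spare. *)
Lemma fast_growth_exists (N : nat -> nat) (g : nat) :
  exists x : nat -> nat, (forall k, (N k + g) ^ 2 <= x k)%N /\
    forall i k, (i < k -> (x i + N i + N k + g) ^ 2 <= x k)%N.
Proof.
pose fix x k := (if k is k'.+1 then (x k' + N k' + N k + g) ^ 2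
                 else (N 0 + g) ^ 2)%N.
have xS k : x k.+1 = ((x k + N k + N k.+1 + g) ^ 2)%N by [].
exists x; split=> [[//|k]|i]; first by rewrite xS leq_sqr; lia.
(* Monotonicity of [x k + N k] reduces the bound for all i < k to consecutive indices, where the
   recursion provides it. *)
have mono j k : (j <= k -> x j + N j <= x k + N k)%N.
  elim: k => [|k IH]; first by rewrite leqn0 => /eqP ->.
  rewrite leq_eqVlt => /orP[/eqP->//|]; rewrite ltnS => /IH jk.
  apply: leq_trans jk _; rewrite xS; nia.
by case=> // k; rewrite ltnS xS leq_sqr => /mono; lia.
Qed.

Definition pieces (N x : nat -> nat) (S : pred nat) : pred nat :=
  fun a => `[< exists k s, [/\ (s < N k)%N, S s & a = (x k + s)%N] >].

Section Pieces.
Variables (N x : nat -> nat) (S : pred nat) (g : nat).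
Hypotheses (g_gt0 : (0 < g)%N)
  (x_large : forall k, ((N k + g) ^ 2 <= x k)%N)
  (x_far : forall i k, (i < k -> (x i + N i + N k + g) ^ 2 <= x k)%N)
  (parallelogram : forall s t s' t', S s -> S t -> S s' -> S t' ->
    (s + t = s' + t' -> s * t < s' * t' -> s * t + g <= s' * t')%N).

Let lower i k : (i < k -> 2 * (x i + N i) + g <= x k)%N.
Proof. by move=> /x_far; nia. Qed.

(** For comparing two products that each have one factor in piece k and one before it: the offset
    terms cannot make up for different coefficients of [x k]. *)
Let lower_cross i k a t : (i < k -> a < x i + N i -> t < N k -> a * t + g <= x k)%N.
Proof.
move=> /x_far xk ha ht.
have : (a * t <= (x i + N i) * N k)%N by apply: leq_mul; apply: ltnW.
nia.
Qed.

(** The earlier factor keeps the left product well below the square of [x k]: a(x_k + t) <= 2a x_k,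
    and 2a + g <= x_k by [lower]. *)
Let mixed_gap i k a t u v : (i < k -> a < x i + N i -> t < N k ->
  a * (x k + t) + g <= (x k + u) * (x k + v))%N.
Proof.
move=> ik ha ht; have lo := lower i k ik; have far := x_large k.
apply: (@leq_trans (x k * x k)); last by apply: leq_mul; lia.
have : ((2 * a + g) * x k <= x k * x k)%N by rewrite leq_mul2r; apply/orP; right; lia.
have : (a * (x k + t) <= a * (2 * x k))%N by apply: leq_mul; nia.
have : (g * 1 <= g * x k)%N by apply: leq_mul; nia.
nia.
Qed.

(** Expand (x_k + s)(x_k + t) as x_k^2 + x_k(s + t) + st. Different sums differ by at least x_k,
    which outweighs st + g; for equal sums [parallelogram] applies. *)
Let piece_gap k s t s' t' : (s < N k)%N -> (t < N k)%N -> S s -> S t ->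
  (s' < N k)%N -> (t' < N k)%N -> S s' -> S t' ->
  ((x k + s) * (x k + t) < (x k + s') * (x k + t') ->
   (x k + s) * (x k + t) + g <= (x k + s') * (x k + t'))%N.
Proof.
move=> sN tN sS tS s'N t'N s'S t'S.
have xE u v : ((x k + u) * (x k + v) = x k * x k + x k * (u + v) + u * v)%N by nia.
have st_lt u v : (u < N k -> v < N k -> u * v + g <= x k)%N.
  move=> uN vN; have : (u * v <= N k * N k)%N by apply: leq_mul; apply: ltnW.
  have := x_large k; nia.
rewrite !xE.
have [lt|gt|eq] := ltngtP (s + t) (s' + t').
- have : (x k * (s + t).+1 <= x k * (s' + t'))%N by rewrite leq_mul2l lt orbT.
  have := st_lt s t sN tN; rewrite mulnS; lia.
- have : (x k * (s' + t').+1 <= x k * (s + t))%N by rewrite leq_mul2l gt orbT.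
  have := st_lt s' t' s'N t'N; rewrite mulnS; lia.
- by rewrite eq -!addnA !ltn_add2l !leq_add2l; apply: parallelogram.
Qed.

Lemma pieces_gap (a b c d : nat) :
  pieces N x S a -> pieces N x S b -> pieces N x S c -> pieces N x S d ->
  (a * b < c * d -> a * b + g <= c * d)%N.
Proof.
move=> /asboolP[i [s [sN sS aE]]] /asboolP[k [t [tN tS bE]]].
move=> /asboolP[i' [s' [s'N s'S cE]]] /asboolP[k' [t' [t'N t'S dE]]].
(* Order the factors of each product so that the second one lies in the later piece. *)
wlog ik : a b i k s t sN sS aE tN tS bE / (i <= k)%N.
  move=> IH; have [ik|/ltnW ki] := leqP i k; first exact: (IH a b i k s t).
  by rewrite (mulnC a); apply: (IH b a k i t s).
wlog ik' : c d i' k' s' t' s'N s'S cE t'N t'S dE / (i' <= k')%N.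
  move=> IH; have [ik'|/ltnW ki'] := leqP i' k'; first exact: (IH c d i' k' s' t').
  by rewrite (mulnC c); apply: (IH d c k' i' t' s').
have xN j l : (j <= l -> x j + N j <= x l + N l)%N.
  by rewrite leq_eqVlt => /orP[/eqP->//|/lower]; lia.
have g_le j : (g <= x j)%N by have := x_large j; nia.
(* If the last pieces differ, the larger [x l'] alone exceeds any product from pieces up to l. *)
have sep j l u v j' l' u' v' : (l < l')%N -> (j <= l)%N ->
    (u < N j)%N -> (v < N l)%N ->
    ((x j + u) * (x l + v) + g <= (x j' + u') * (x l' + v'))%N.
  move=> ll' jl uN vN; have far := x_far l l' ll'.
  have xj := xN j l jl; have gj := g_le j'.
  have : ((x j + u) * (x l + v) <= (x l + N l) * (x l + N l))%N by apply: leq_mul; lia.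
  have : (1 * x l' <= (x j' + u') * (x l' + v'))%N by apply: leq_mul; lia.
  nia.
have [kk'|k'k|kk'] := ltngtP k k'.
- by move=> _; rewrite aE bE cE dE; apply: sep.
- by have := sep i' k' s' t' i k s t k'k ik' s'N t'N; rewrite -aE -bE -cE -dE; lia.
rewrite -kk' {k' kk'} in t'N dE ik'.
(* Both products have last piece k; the four cases tell whether the first factors also lie in it. If
   only the first product is inside piece k, [mixed_gap] contradicts the assumed order. *)
move: ik ik'; rewrite leq_eqVlt => /orP[/eqP ik|ik];
  rewrite leq_eqVlt => /orP[/eqP ik'|ik'].
- rewrite aE bE cE dE ik ik'; apply: piece_gap => //.
    by rewrite -ik.
  by rewrite -ik'.
- have := mixed_gap i' k c t' s t ik' _ t'N.
  rewrite -dE -{1}ik -aE -bE cE; lia.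
- move=> _; rewrite bE cE dE ik'; apply: (mixed_gap i) => //; lia.
have ax : (a < x i + N i)%N by lia.
have cx : (c < x i' + N i')%N by lia.
have := lower_cross i k a t ik ax tN; have := lower_cross i' k c t' ik' cx t'N.
rewrite bE dE !mulnDr => hc ha.
(* Compare a x_k + at with c x_k + ct'. When a = c, the difference is a positive multiple of c, and
   c >= x_i' >= g. *)
have [ac|ca|->] := ltngtP a c.
- have : (a.+1 * x k <= c * x k)%N by rewrite leq_mul2r ac orbT.
  rewrite mulSn; lia.
- have : (c.+1 * x k <= a * x k)%N by rewrite leq_mul2r ca orbT.
  rewrite mulSn; lia.
rewrite ltn_add2l -addnA leq_add2l ltn_mul2l => /andP[_ tt'].
have : (c * t.+1 <= c * t')%N by rewrite leq_mul2l tt' orbT.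
have := g_le i'; rewrite mulnS; lia.
Qed.
End Pieces.

(** * Banach density, enumeration and the set A *)

Local Open Scope classical_set_scope.

(** A set of the filter contains all intervals of length at least some k, hence [I k]; so every
    supremum in the infimum is at least [delta]. *)
Lemma upper_banach_density_ge (R : realType) (A : set int) (delta : R)
    (I : nat -> int * nat) :
  (forall k, k <= (I k).2)%N -> (forall k, delta <= itv_density R A (I k)) ->
  (delta%:E <= upper_banach_density R A)%E.
Proof.
move=> I_long I_dense; rewrite upper_banach_densityE.
apply: le_ereal_inf_tmp => _ [V [k _ kV] <-].
apply: (@le_trans _ _ (itv_density R A (I k))%:E); first by rewrite lee_fin.
apply: ereal_sup_ubound; exists (I k) => //; apply: kV.
by rewrite /= /int_itv size_map size_iota.
Qed.

Lemma increasing_enum_exists (P : pred nat) :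
  (forall m, exists n, (m <= n)%N && P n) ->
  exists b : nat -> nat, {homo b : m n / (m < n)%N} /\ range b = [set n | P n].
Proof.
move=> unb.
pose next m := ex_minn (unb m).
have nextP m : [/\ (m <= next m)%N, P (next m) &
    forall n, (m <= n)%N -> P n -> (next m <= n)%N].
  rewrite /next; case: ex_minnP => n /andP[mn Pn] n_min; split=> // p mp Pp.
  by apply: n_min; rewrite mp.
pose b := fix b k := if k is k'.+1 then next (b k').+1 else next 0%N.
have bS k : b k.+1 = next (b k).+1 by [].
have b_lt k : (b k < b k.+1)%N by rewrite bS; case: (nextP (b k).+1).
exists b; split; first by apply: homo_ltn => //; apply: ltn_trans.
apply/seteqP; split => [_ [k _ <-]/=|p /= Pp].
  by case: k => [|k]; [case: (nextP 0%N)|rewrite bS; case: (nextP (b k).+1)].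
have b_ge k : (k <= b k)%N by elim: k => // k IH; apply: leq_ltn_trans IH (b_lt k).
(* The least k with p <= b k satisfies b k = p: for k > 0, b (k - 1) < p makes p a candidate in the
   minimum defining b k. *)
have [k pk k_min] := ex_minnP (ex_intro (fun k => p <= b k)%N p (b_ge p)).
exists k => //; apply/eqP; rewrite eqn_leq pk andbT.
case: k k_min {pk} => [|k] k_min; first by case: (nextP 0%N) => _ _; apply.
rewrite bS; case: (nextP (b k).+1) => _ _; apply=> //.
by rewrite ltnNge; apply/negP => /k_min; rewrite ltnn.
Qed.

Lemma dense_set_with_product_gaps (R : realType) (n h : nat) (T : {set 'I_n}) :
  (0 < h)%N -> (h <= n)%N -> (0 < #|T|)%N -> sidon_mod T ->
  (forall a b : 'I_n, a \in T -> b \in T -> a != b -> (h <= (b + n - a) %% n)%N) ->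
  exists A : set int,
    [/\ infinite_set A, forall a : int, A a -> 0 < a,
        ((#|T|%:R / n%:R)%:E <= upper_banach_density R A)%E &
        exists b : nat -> int, increasing_enum (product_set A) b /\
          forall k : nat, b k + (h * n)%:Z <= b k.+1].
Proof.
move=> h_gt0 hn T_gt0 sT gapT.
have n_gt0 : (0 < n)%N by apply: leq_trans hn.
(* A piece spans k + 1 whole periods, so its offsets have density exactly [#|T| / n], and the piece
   lengths tend to infinity. *)
pose N k := (k.+1 * n)%N.
have [x [x_large x_far]] := fast_growth_exists N (h * n).
pose P := pieces N x (lift_mod T).
have Pgap := pieces_gap N x (lift_mod T) (h * n) _ x_large x_far
  (lift_mod_parallelogram n h T hn sT gapT).
have g_gt0 : (0 < h * n)%N by rewrite muln_gt0 h_gt0.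
have P_gt0 a : P a -> (0 < a)%N.
  by move=> /asboolP[k [s [_ _ ->]]]; have := x_large k; nia.
have [s0 s0N s0T] : exists2 s, (s < n)%N & lift_mod T s.
  have [s sT'] : {s | s \in T} by apply/sigW/card_gt0P.
  by exists s => //; apply/exists_inP; exists s; rewrite // modn_small.
have P_unb m : exists a, (m <= a)%N && P a.
  exists (x m + s0)%N; apply/andP; split; first by have := x_large m; rewrite /N; nia.
  by apply/asboolP; exists m, s0; split; rewrite // /N mulSn; lia.
have itvE k j : (j < N k)%N -> lift_mod T j -> P (x k + j)%N.
  by move=> jN jT; apply/asboolP; exists k, j.
pose A := [set a%:Z | a in [set a : nat | P a]].
exists A; split.
- move=> A_fin; have [b [b_incr bE]] := increasing_enum_exists P P_unb.
  have b_inj : injective (fun k => Posz (b k)).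
    move=> i j [bij]; have [/b_incr|/b_incr|//] := ltngtP i j; lia.
  apply: infinite_nat; apply: sub_finite_set (finite_preimage (in2W b_inj) A_fin).
  move=> k _ /=; exists (b k) => //; have /seteqP[bP _] := bE; by apply: bP; exists k.
- by move=> _ [a /P_gt0 a_gt0 <-].
- apply: (@upper_banach_density_ge _ _ _ (fun k => ((x k)%:Z, N k))) => /= k.
    by rewrite /N; nia.
  rewrite /itv_density /int_itv size_map size_iota count_map /=.
  rewrite ler_pdivlMr ?ltr0n ?muln_gt0 // /N natrM mulrA mulrAC.
  rewrite divfK ?pnatr_eq0 -?lt0n //.
  rewrite -natrM mulnC ler_nat -count_lift_mod.
  rewrite (@eq_in_count _ _ [pred j | (j < N k)%N && lift_mod T j]); last first.
    by move=> j; rewrite mem_iota /= add0n => ->.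
  apply: sub_count => j /andP[jN jT].
  by apply/mem_set; exists (x k + j)%N; [exact: itvE|rewrite PoszD].
pose Q := [pred p : nat | `[< exists a b : nat, [/\ P a, P b & p = a * b]%N >]].
have [m|b [b_incr bE]] := increasing_enum_exists Q.
  have [a /andP[ma Pa]] := P_unb m; exists (a * a)%N; apply/andP; split; first by nia.
  by apply/asboolP; exists a, a.
have bQ k : Q (b k) by have /seteqP[bQ _] := bE; apply: bQ; exists k.
exists (fun k => (b k)%:Z); split; first split.
- by move=> i j /b_incr; rewrite ltz_nat.
- apply/seteqP; split=> [_ [k _ <-]|_ [_ [a Pa <-] [_ [c Pc <-] <-]]].
    have /asboolP[a [c [Pa Pc ->]]] := bQ k.
    by exists a%:Z; [exists a|exists c%:Z => //; exists c].
  have /seteqP[_ /(_ (a * c)%N)[|k _ kE]] := bE; last by exists k; rewrite // kE.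
  by apply/asboolP; exists a, c.
move=> k; rewrite -PoszD lez_nat.
have /asboolP[a1 [a2 [P1 P2 E1]]] := bQ k.
have /asboolP[a3 [a4 [P3 P4 E2]]] := bQ k.+1.
by rewrite E1 E2; apply: Pgap => //; rewrite -E1 -E2; apply: b_incr.
Qed.

(** * Choice of the parameters in terms of alpha *)

Lemma pow2_scale_exists (R : realType) (x : R) : 2 <= x ->
  exists2 m : nat, (0 < m)%N & (2 ^ m)%:R <= x < (2 ^ m.+1)%:R.
Proof.
move=> x2; have x_ge0 : 0 <= x by lra.
have ex : exists m, x < (2 ^ m)%:R.
  exists (Num.trunc x).+1; apply: lt_le_trans (truncnS_gt x) _.
  by rewrite ler_nat ltnW // ltn_expl.
have [[|[|m]] xm m_min] := ex_minnP ex; [lra|lra|exists m.+1 => //].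
by rewrite xm andbT leNgt; apply/negP => /m_min; rewrite ltnn.
Qed.

Theorem theorem2 (R : realType) :
  exists c : R, 0 < c /\
    forall alpha : R, 0 < alpha -> alpha < 1 ->
      exists A : set int,
        [/\ infinite_set A,
            forall a : int, A a -> 0 < a,
            (alpha%:E < upper_banach_density R A)%E &
            exists b : nat -> int,
              increasing_enum (product_set A) b /\
              forall n : nat, c * alpha ^- 3 <= (b n.+1 - b n)%:~R].
Proof.
(* With alpha^-1 < 8h and hn = 4h^3 - h >= 2h^3, as obtained below, alpha^-3 <= 512h^3 <= 256hn. *)
exists 256^-1; split => [|alpha a_gt0 a_lt1]; first by rewrite invr_gt0.
suff [n [h [T [h_gt0 hn sT gapT [densT gapn]]]]] : exists (n h : nat) (T : {set 'I_n}),
    [/\ (0 < h)%N, (h <= n)%N, sidon_mod T,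
      forall a b : 'I_n, a \in T -> b \in T -> a != b -> (h <= (b + n - a) %% n)%N &
      alpha < #|T|%:R / n%:R /\ 256^-1 * alpha ^- 3 <= (h * n)%:R].
  have T_gt0 : (0 < #|T|)%N.
    by rewrite lt0n; apply/negP => /eqP T0; move: densT; rewrite T0 mul0r; lra.
  have [A [A_inf A_gt0 A_dens [b [bE b_gap]]]] :=
    dense_set_with_product_gaps R n h T h_gt0 hn T_gt0 sT gapT.
  exists A; split => //; first by apply: lt_le_trans A_dens; rewrite lte_fin.
  exists b; split => // k; apply: le_trans gapn _.
  by rewrite -[_%:R]/((h * n)%:Z%:~R) ler_int lerBrDl.
(* For alpha > 1/4 take all residues modulo 1: the density is 1, and alpha^-3 < 64 makes the
   required gap less than 1. *)
have [a_small|a_big] := leP alpha 4^-1; last first.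
  exists 1%N, 1%N, [set: 'I_1]%SET; split => //.
  - by move=> a b c d _ _ _ _ _; left; rewrite !ord1.
  - by move=> a b _ _; rewrite !ord1 eqxx.
  rewrite cardsT card_ord divr1; split => //.
  have : alpha^-1 ^+ 3 <= 4 ^+ 3.
    rewrite lerXn2r ?nnegrE ?invr_ge0 ?(ltW a_gt0) //.
    by rewrite -[4]invrK lef_pV2 ?posrE ?ltW // invr_gt0.
  rewrite exprVn; lra.
(* Here q = 2 ^ m is the largest power of two not exceeding 1/(2 alpha), which is at least 2 since
   alpha <= 1/4. *)
have [m m_gt0 /andP[qa aq]] : exists2 m : nat, (0 < m)%N &
    (2 ^ m)%:R <= (2 * alpha)^-1 < (2 ^ m.+1)%:R.
  apply: pow2_scale_exists; rewrite -[2]invrK lef_pV2 ?posrE; lra.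
have [T0 T0_card sT0] := sidon_mod_Bose m m_gt0.
have [h qE] : exists h, (2 ^ m = 2 * h)%N.
  by exists (2 ^ m.-1)%N; rewrite -expnS prednK.
have [T [TT0 T_card gapT]] := sidon_mod_thin _ h T0 sT0.
exists ((2 ^ m) ^ 2 - 1)%N, h, T.
have h_gt0 : (0 < h)%N by have := expn_gt0 2 m; lia.
split => //.
- by rewrite qE; nia.
- move=> a b c d aT bT cT dT.
  by apply: sT0; apply: (fintype.subsetP TT0).
have h_ge1 : 1 <= h%:R :> R by rewrite ler1n.
have hT : (h <= #|T|)%N by lia.
have hT' : h%:R <= #|T|%:R :> R by rewrite ler_nat.
have nE : ((2 ^ m) ^ 2 - 1)%:R = 4 * h%:R ^+ 2 - 1 :> R.
  by rewrite qE natrB ?natrX ?natrM; [ring|nia].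
rewrite qE natrM invfM in qa; rewrite expnS qE !natrM invfM in aq.
have ah : 4 * (alpha * h%:R) <= 1.
  have ai : alpha * alpha^-1 = 1 by rewrite mulfV ?gt_eqF.
  have : alpha * (2 * h%:R) <= alpha * (2^-1 * alpha^-1) by rewrite ler_pM2l.
  by rewrite (mulrCA alpha 2^-1) ai; lra.
split.
  (* [T] keeps at least q - h = h elements, and h/(4h^2 - 1) > 1/(4h) >= alpha; the -1 in n gives
     strictness. *)
  rewrite nE ltr_pdivlMr; nra.
have : alpha^-1 ^+ 3 <= (8 * h%:R) ^+ 3.
  rewrite lerXn2r ?nnegrE ?invr_ge0 ?(ltW a_gt0) ?mulr_ge0 //; lra.
rewrite exprVn natrM nE; nra.
Qed.
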